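(* Let $W$ be the graph defined below, and let $W_1$ be the graph obtained from a copy $W_0$ of $W$ by replacing each of the three edges $uz$, $ux_1$, $ut$ of $W_0$ with a distinct copy of $W$, where the vertices $u$ and $v$ of that copy are identified with the two endpoints of the edge. Then the fractional arboricity of $W_1$ is $a_f(W_1)=2+\frac{2}{25}$.
   Context: $W$ is the graph on the ten vertices $u,v,w,z,t,x_1,x_2,x_3,x_4,x_5$ with the $24$ edges $wx_1,wx_2,wx_3,wx_4,wx_5$; $x_1x_2,x_2x_3,x_3x_4,x_4x_5,x_5x_1$; $zx_2,zx_3,zu,zv$; $tx_4,tx_5,tu,tv$; $ux_1,ux_2,ux_5,uv$; $vx_3,vx_4$ (it is a planar triangulation). The fractional arboricity $a_f(G)$ of a graph $G$ is the minimum of $p/q$ over positive integers $p,q$ such that one can assign to each vertex a set of $q$ colors from $\{1,\dots,p\}$ so that for each color the set of vertices receiving it induces a forest (acyclic subgraph). *)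

(* Defs.v *)
From HB Require Import structures.
From mathcomp Require Import all_boot all_order all_algebra.

Set Implicit Arguments.
Unset Strict Implicit.
Unset Printing Implicit Defensive.

Import Order.TTheory GRing.Theory Num.Theory.

(* A finite simple graph is a symmetric irreflexive relation on a finType. *)

Definition induces_forest (T : finType) (e : rel T) (A : {set T}) : Prop :=
  forall c : seq T, {subset c <= A} -> 2 < size c -> ~ ucycle e c.

Definition forest_coloring (T : finType) (e : rel T) (p q : nat)
    (c : T -> {set 'I_p}) : Prop :=
  (forall x : T, #|c x| = q) /\
  (forall i : 'I_p, induces_forest e [set x | i \in c x]).

Definition forest_colorable (T : finType) (e : rel T) (p q : nat) : Prop :=
  exists c : T -> {set 'I_p}, forest_coloring e q c.

Definition is_frac_arboricity (T : finType) (e : rel T) (a : rat) : Prop :=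
  (exists p q : nat, [/\ 0 < p, 0 < q, forest_colorable e p q
                       & a = (p%:R / q%:R)%R]) /\
  (forall p q : nat, 0 < p -> 0 < q -> forest_colorable e p q ->
     (a <= p%:R / q%:R)%R).

Inductive Wvertex := Wu | Wv | Ww | Wz | Wt | Wx1 | Wx2 | Wx3 | Wx4 | Wx5.

Definition Wvertex_seq : seq Wvertex :=
  [:: Wu; Wv; Ww; Wz; Wt; Wx1; Wx2; Wx3; Wx4; Wx5].

Definition Wvertex_nat (x : Wvertex) : nat :=
  match x with
  | Wu => 0 | Wv => 1 | Ww => 2 | Wz => 3 | Wt => 4
  | Wx1 => 5 | Wx2 => 6 | Wx3 => 7 | Wx4 => 8 | Wx5 => 9
  end.

Lemma Wvertex_natK : cancel Wvertex_nat (nth Wu Wvertex_seq).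
Proof. by case. Qed.

HB.instance Definition _ := Countable.copy Wvertex (can_type Wvertex_natK).

Lemma Wvertex_seqP : Finite.axiom Wvertex_seq.
Proof. by case. Qed.

HB.instance Definition _ := isFinite.Build Wvertex Wvertex_seqP.

Definition W_edges : seq (Wvertex * Wvertex) :=
  [:: (Ww, Wx1); (Ww, Wx2); (Ww, Wx3); (Ww, Wx4); (Ww, Wx5);
      (Wx1, Wx2); (Wx2, Wx3); (Wx3, Wx4); (Wx4, Wx5); (Wx5, Wx1);
      (Wz, Wx2); (Wz, Wx3); (Wz, Wu); (Wz, Wv);
      (Wt, Wx4); (Wt, Wx5); (Wt, Wu); (Wt, Wv);
      (Wu, Wx1); (Wu, Wx2); (Wu, Wx5); (Wu, Wv);
      (Wv, Wx3); (Wv, Wx4)].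

Definition W : rel Wvertex :=
  fun x y => ((x, y) \in W_edges) || ((y, x) \in W_edges).

Lemma W_sym : symmetric W.
Proof. by move=> x y; rewrite /W orbC. Qed.

Lemma W_irr : irreflexive W.
Proof. by case. Qed.

(* Replacing k edges of a graph e on T by copies of a graph h on H: the i-th
   replaced edge joins (ends i).1 to (ends i).2, and in the i-th copy of h the
   vertices a and b are identified with (ends i).1 and (ends i).2. *)
Section ReplaceEdges.
Variables (T : finType) (e : rel T) (H : finType) (h : rel H) (a b : H).
Variables (k : nat) (ends : 'I_k -> T * T).

Definition inner : finType := {x : H | (x != a) && (x != b)}.

Definition repl_vertex : finType := (T + 'I_k * inner)%type.

Definition in_copy (i : 'I_k) (x : H) : repl_vertex :=
  if insub x is Some y then inr (i, y : inner)
  else if x == a then inl (ends i).1 else inl (ends i).2.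

Definition replaced (x y : T) : bool :=
  [exists i, (ends i == (x, y)) || (ends i == (y, x))].

Definition repl_edges : rel repl_vertex := fun p q =>
  [exists x, exists y, [&& e x y, ~~ replaced x y, p == inl x & q == inl y]]
  || [exists i, exists x, exists y,
        [&& h x y, p == in_copy i x & q == in_copy i y]].

End ReplaceEdges.

Arguments repl_edges {T} e {H} h a b {k} ends.

(* The two ways of identifying the vertices u, v of a copy with the endpoints
   of the edge it replaces need not give isomorphic graphs, as no automorphism
   of W swaps u and v (they have degrees 6 and 5).  For the i-th of the edges
   uz, ux1, ut, v is identified with z, x1, t respectively when flip i is
   false, and with u when flip i is true. *)
Definition W1_ends (flip : 'I_3 -> bool) (i : 'I_3) : Wvertex * Wvertex :=
  let y := tnth [tuple Wz; Wx1; Wt] i in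
  if flip i then (y, Wu) else (Wu, y).

Definition W1 (flip : 'I_3 -> bool) :=
  repl_edges W W Wu Wv (W1_ends flip).

Lemma W1_sym flip : symmetric (W1 flip).
Proof.
suff sub p q : W1 flip p q -> W1 flip q p by move=> p q; apply/idP/idP; apply: sub.
case/orP.
  case/existsP=> x /existsP[y /and4P[exy nr px qy]].
  apply/orP; left; apply/existsP; exists y; apply/existsP; exists x.
  rewrite W_sym exy px qy /= andbT; apply: contra nr => /existsP[i].
  by rewrite orbC => ?; apply/existsP; exists i.
case/existsP=> i /existsP[x /existsP[y /and3P[exy px qy]]].
apply/orP; right; apply/existsP; exists i; apply/existsP; exists y.
by apply/existsP; exists x; rewrite W_sym exy px qy.
Qed.

Lemma W1_irr flip : irreflexive (W1 flip).
Proof.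
move=> p; apply/negP; case/orP.
  case/existsP=> x /existsP[y /and4P[exy _ /eqP-> /eqP[xy]]].
  by rewrite xy W_irr in exy.
case/existsP=> i /existsP[x /existsP[y /and3P[exy /eqP-> /eqP eq_c]]].
have d : (W1_ends flip i).1 != (W1_ends flip i).2.
  by rewrite /W1_ends; case: (flip i); case: i {eq_c} => -[|[|[|]]].
suff xy : x = y by rewrite xy W_irr in exy.
move: eq_c; rewrite /in_copy.
case: insubP => [x' _ <-|nx]; case: insubP => [y' _ <-|ny].
- by case=> ->.
- by case: ifP.
- by case: ifP.
move: nx ny; rewrite !negb_and !negbK.
case: (eqVneq x Wu) => [->|_] /=; case: (eqVneq y Wu) => [->|_] //=.
- by move=> _ _ [] E; rewrite E eqxx in d.
- by move=> _ _ [] E; rewrite E eqxx in d.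
by move=> /eqP-> /eqP->.
Qed.

(* Main.v *)
Require Import Defs.
From mathcomp Require Import all_boot all_order all_algebra.
From mathcomp Require Import zify.

Set Implicit Arguments.
Unset Strict Implicit.
Unset Printing Implicit Defensive.

Import Order.TTheory GRing.Theory Num.Theory.

(* Every induced forest F of W satisfies |F| + [u, v in F] <= 5 and
   2|F| + 2[u in F] <= 10 + [u, z in F] + [u, x1 in F] + [u, t in F].  Summed
   over the p colour classes of a colouring with q colours per vertex, the first
   bound, applied to the three copies, says that u shares at most 5p - 10q
   colours with each of z, x1, t; the second, applied to W_0, then gives
   22q <= 10p + 3(5p - 10q), that is 52q <= 25p.

   Conversely, since the replaced edges remain present in W_1, a vertex set of
   W_1 induces a forest as soon as its traces on W_0 and on the copies do, so
   colourings of these graphs can be glued once they agree on the replaced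
   edges.  Colourings with p = 52 and q = 25 in which the ends of each replaced
   edge share 10 colours always agree up to a permutation of the colours,
   whichever way u and v are identified with the ends. *)

(** * Induced forests and ranking certificates *)

Lemma induces_forest_preim (T T' : finType) (e : rel T) (e' : rel T')
    (f : T -> T') (A : {set T'}) :
  injective f -> (forall x y, e x y -> e' (f x) (f y)) ->
  induces_forest e' A -> induces_forest e (f @^-1: A).
Proof.
move=> f_inj f_hom forestA c cA c_gt2 /andP[c_cycle c_uniq].
apply: (forestA (map f c)); rewrite ?size_map //.
  by move=> _ /mapP[x /cA xA ->]; rewrite inE in xA.
apply/andP; split; last by rewrite map_inj_uniq.
by rewrite cycle_map; apply: sub_cycle c_cycle => x y /f_hom.
Qed.

(** A certificate of acyclicity. Ties count as lower neighbours, so [r] need not be injective. *)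
Definition forest_rank (T : eqType) (e : rel T) (P : pred T) (r : T -> nat) :=
  forall x y z, P x -> P y -> P z -> e x y -> e x z ->
    r y <= r x -> r z <= r x -> y = z.

(* A vertex of maximal rank on a cycle would have two lower neighbours. *)
Lemma forest_rank_induces_forest (T : finType) (e : rel T) (A : {set T})
    (r : T -> nat) :
  symmetric e -> forest_rank e (mem A) r -> induces_forest e A.
Proof.
move=> e_sym rankA [//|x0 c'] cA c_gt2 /andP[c_cycle c_uniq].
set c := x0 :: c' in cA c_gt2 c_cycle c_uniq.
have [x xc x_max] : exists2 x, x \in c & forall y, y \in c -> r y <= r x.
  case: (@arg_maxnP T x0 (mem c) r); first exact: mem_head.
  by move=> x xc x_max; exists x.
have nc : next c x \in c by rewrite mem_next.
have pc : prev c x \in c by rewrite mem_prev.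
have eq_np : next c x = prev c x.
  have exn : e x (next c x) by apply: next_cycle.
  have exp : e x (prev c x) by rewrite e_sym; apply: prev_cycle.
  by apply: (rankA x); rewrite ?x_max //; apply: cA.
(* A duplicate-free cycle on which two steps forward return to [x] has at most two vertices;
   rotating [x] to the front makes this computable. *)
have nnx : next c (next c x) = x by rewrite eq_np next_prev.
have [i s def_s] := rot_to xc.
move: c_gt2 c_uniq nnx (c_uniq).
rewrite -{1}(size_rot i) -{1}(rot_uniq i) => s_gt2 s_uniq nnx c_uniq.
move: nnx s_gt2 s_uniq; rewrite -!(next_rot i c_uniq) def_s.
case: s {def_s} => [|y [|z s]] //=; rewrite eqxx.
case: (eqVneq y x) => [->|_]; first by rewrite mem_head.
by rewrite eqxx => -> _; rewrite !inE eqxx !orbT.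
Qed.

(** * Embeddings and forests in a graph with replaced edges *)

Section ReplaceEdges.
Variables (T : finType) (e : rel T) (H : finType) (h : rel H) (a b : H).
Variables (k : nat) (ends : 'I_k -> T * T).

Local Notation inc := (in_copy a b ends).
Local Notation G := (repl_edges e h a b ends).

Lemma in_copy_a i : inc i a = inl (ends i).1.
Proof. by rewrite /in_copy insubF ?eqxx. Qed.

Lemma in_copy_b i : a != b -> inc i b = inl (ends i).2.
Proof.
by move=> ab; rewrite /in_copy insubF ?eqxx ?andbF // eq_sym (negPf ab).
Qed.

Lemma in_copy_val i (y : inner a b) : inc i (val y) = inr (i, y).
Proof. by rewrite /in_copy valK. Qed.

Variant in_copy_spec (i : 'I_k) (x : H) : repl_vertex T a b k -> Type :=
  | InCopyA of x = a : in_copy_spec i x (inl (ends i).1)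
  | InCopyB of x = b : in_copy_spec i x (inl (ends i).2)
  | InCopyInner (y : inner a b) of x = val y : in_copy_spec i x (inr (i, y)).

Lemma in_copyP i x : in_copy_spec i x (inc i x).
Proof.
rewrite /in_copy; case: insubP => [y _ <-|]; first exact: InCopyInner.
rewrite negb_and !negbK; case: eqVneq => [-> _|_ /= /eqP->].
  exact: InCopyA.
exact: InCopyB.
Qed.

Lemma in_copy_inj i : (ends i).1 != (ends i).2 -> injective (inc i).
Proof.
move=> ends_neq x y.
case: (in_copyP i x) => [->|->|x' ->]; case: (in_copyP i y) => [->|->|y' ->] //.
- by case=> E; rewrite E eqxx in ends_neq.
- by case=> E; rewrite E eqxx in ends_neq.
by case=> ->.
Qed.

Lemma in_copy_hom i x y : h x y -> G (inc i x) (inc i y).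
Proof.
move=> hxy; apply/orP; right; apply/existsP; exists i.
by apply/existsP; exists x; apply/existsP; exists y; rewrite hxy !eqxx.
Qed.

(** A replaced edge survives as the edge [a b] of its copy, possibly read backwards. *)
Lemma inl_hom x y : a != b -> symmetric h -> h a b -> e x y ->
  G (inl x) (inl y).
Proof.
move=> ab h_sym hab exy; case: (boolP (replaced ends x y)) => [|nr].
  case/existsP=> i /orP[] /eqP Ei.
    by have := in_copy_hom i hab; rewrite in_copy_a in_copy_b // Ei.
  rewrite h_sym in hab.
  by have := in_copy_hom i hab; rewrite in_copy_a in_copy_b // Ei.
apply/orP; left; apply/existsP; exists x; apply/existsP; exists y.
by rewrite exy nr !eqxx.
Qed.

(** Within a copy only [a] and [b] are sent to vertices of [T], so an edge of the copy between such
    vertices joins the two ends of a replaced edge. *)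
Lemma repl_edges_inl x y : symmetric e -> irreflexive h ->
  (forall i, e (ends i).1 (ends i).2) -> G (inl x) (inl y) -> e x y.
Proof.
move=> e_sym h_irr e_ends /orP[].
  by case/existsP=> x' /existsP[y' /and4P[? _ /eqP[->] /eqP[->]]].
case/existsP=> i /existsP[x' /existsP[y' /and3P[]]].
case: (in_copyP i x') => [->|->|x'' ->] //; case: (in_copyP i y') => [->|->|y'' ->] //.
- by rewrite h_irr.
- by move=> _ /eqP[->] /eqP[->].
- by move=> _ /eqP[->] /eqP[->]; rewrite e_sym.
by rewrite h_irr.
Qed.

Lemma repl_edges_inr i y q : G (inr (i, y)) q -> exists2 x, q = inc i x & h (val y) x.
Proof.
case/orP; first by case/existsP=> x' /existsP[y' /and4P[]].
case/existsP=> j /existsP[x /existsP[x' /and3P[]]].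
case: (in_copyP j x) => // y' -> hxx' /eqP[-> ->] /eqP->.
by exists x'.
Qed.

(* In each copy the ranks of the two glued vertices must come first, so that the
   inner vertices can be ranked after all the vertices of [T]. *)
Lemma repl_edges_forest (A : {set repl_vertex T a b k})
    (r : T -> nat) (s : 'I_k -> H -> nat) :
  symmetric e -> irreflexive h -> (forall i, e (ends i).1 (ends i).2) ->
  symmetric G ->
  forest_rank e (fun x => inl x \in A) r ->
  (forall i, forest_rank h (fun x => inc i x \in A) (s i)) ->
  (forall i (y : inner a b), s i a <= s i (val y) /\ s i b <= s i (val y)) ->
  induces_forest G A.
Proof.
move=> e_sym h_irr e_ends G_sym rk_r rk_s s_root.
pose N := \max_x r x.
have r_le x : r x <= N by apply: leq_bigmax.
pose rk (p : repl_vertex T a b k) :=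
  match p with inl x => r x | inr (i, y) => (N + s i (val y)).+1 end.
apply: (@forest_rank_induces_forest _ _ _ rk) => // -[x|[i x]].
  move=> [y|[j y]] [z|[j' z]] /= Ax Ay Az Gxy Gxz.
  - move=> ryx rzx; congr inl; apply: (rk_r x) => //; exact: repl_edges_inl.
  - by move: (r_le x); lia.
  - by move: (r_le x); lia.
  - by move: (r_le x); lia.
(* Between inner vertices the offset [N] cancels; for a glued vertex [rk] comes from [r] and tells
   nothing about [s i], so [s_root] is used instead. *)
have rk_copy y : rk (inc i y) <= rk (inr (i, x)) -> s i y <= s i (val x).
  case: (in_copyP i y) => [->|->|y' ->] /=; first by case: (s_root i x).
    by case: (s_root i x).
  by rewrite ltnS leq_add2l.
move=> p q Ax Ap Aq /repl_edges_inr[y Ep hxy] /repl_edges_inr[z Eq hxz].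
rewrite {}Ep {}Eq in Ap Aq * => /rk_copy le_y /rk_copy le_z.
by congr inc; apply: (rk_s i (val x)) => //=; rewrite in_copy_val.
Qed.

End ReplaceEdges.

(** * Restriction of colourings and double counting *)

Lemma forest_coloring_preim (T T' : finType) (e : rel T) (e' : rel T')
    (p q : nat) (c : T' -> {set 'I_p}) (f : T -> T') :
  injective f -> (forall x y, e x y -> e' (f x) (f y)) ->
  forest_coloring e' q c -> forest_coloring e q (c \o f).
Proof.
move=> f_inj f_hom [c_card c_forest]; split=> [x|i]; first exact: c_card.
have -> : [set x | i \in (c \o f) x] = f @^-1: [set x | i \in c x].
  by apply/setP=> x; rewrite !inE.
exact: induces_forest_preim (c_forest i).
Qed.

Lemma sum_card_color_classes (T : finType) (p : nat) (c : T -> {set 'I_p}) :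
  \sum_(i < p) #|[set x | i \in c x]| = \sum_x #|c x|.
Proof.
transitivity (\sum_(i < p) \sum_x (i \in c x : nat)).
  by apply: eq_bigr => i _; rewrite -sum1_card big_mkcond; apply: eq_bigr => x _;
    rewrite inE; case: ifP.
rewrite exchange_big; apply: eq_bigr => x _.
by rewrite -sum1_card [RHS]big_mkcond; apply: eq_bigr => i _; case: ifP.
Qed.

Lemma sum_mem_setI (p : nat) (A B : {set 'I_p}) :
  \sum_(i < p) ((i \in A) && (i \in B) : nat) = #|A :&: B|.
Proof.
rewrite -sum1_card [RHS]big_mkcond; apply: eq_bigr => i _.
by rewrite inE; case: (_ && _).
Qed.

(** * Bounds on the induced forests of [W], by enumeration *)

Fixpoint subseqs (T : Type) (s : seq T) : seq (seq T) :=
  if s is x :: s' then let r := subseqs s' in map (cons x) r ++ r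
  else [:: [::]].

Lemma filter_in_subseqs (T : eqType) (P : pred T) (s : seq T) :
  filter P s \in subseqs s.
Proof.
elim: s => //= x s IHs; rewrite mem_cat; case: (P x); last by rewrite IHs orbT.
by rewrite map_f.
Qed.

(* Enough cycles to rule out every vertex set violating one of the two bounds
   below. *)
Definition W_cycles : seq (seq Wvertex) :=
  [:: [:: Wu; Wv; Wz]; [:: Wu; Wv; Wt]; [:: Wu; Wz; Wx2]; [:: Wu; Wx1; Wx2];
      [:: Ww; Wx1; Wx2]; [:: Wv; Wz; Wx3]; [:: Ww; Wx2; Wx3];
      [:: Wz; Wx2; Wx3]; [:: Wv; Wt; Wx4]; [:: Wv; Wx3; Wx4];
      [:: Ww; Wx3; Wx4]; [:: Wu; Wt; Wx5]; [:: Wu; Wx1; Wx5];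
      [:: Ww; Wx1; Wx5]; [:: Ww; Wx4; Wx5]; [:: Wt; Wx4; Wx5];
      [:: Wu; Wv; Wx3; Wx2]; [:: Wu; Wx2; Ww; Wx5]; [:: Wu; Wv; Wx4; Wx5];
      [:: Wu; Wv; Wx3; Ww; Wx1]; [:: Wu; Wz; Wx3; Ww; Wx1];
      [:: Wu; Wv; Wx4; Ww; Wx1]; [:: Wu; Wt; Wx4; Ww; Wx1];
      [:: Wu; Wv; Wx4; Ww; Wx2]; [:: Wu; Wt; Wx4; Ww; Wx2];
      [:: Wu; Wz; Wx3; Wx4; Wt]; [:: Wu; Wt; Wx4; Wx3; Wx2];
      [:: Wu; Wv; Wx3; Ww; Wx5]; [:: Wu; Wz; Wx3; Ww; Wx5];
      [:: Wu; Wz; Wx3; Wx4; Wx5]; [:: Wu; Wx2; Wx3; Wx4; Wx5];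
      [:: Wv; Wz; Wx2; Ww; Wx5; Wt]; [:: Wv; Wz; Wx2; Wx1; Wx5; Wt];
      [:: Wv; Wt; Wx5; Wx1; Wx2; Wx3]; [:: Wv; Wz; Wx2; Wx1; Wx5; Wx4]].

(** Turns a bound into a computation over the 1024 sublists of the vertex list: a sublist containing
    a listed cycle cannot come from a forest. *)
Lemma W_forest_ind (A : {set Wvertex}) (Q : pred (seq Wvertex)) :
  all (fun s => has (fun c => all (mem s) c) W_cycles || Q s)
      (subseqs Wvertex_seq) ->
  induces_forest W A -> Q [seq x <- Wvertex_seq | x \in A].
Proof.
move=> /allP/(_ _ (filter_in_subseqs (mem A) Wvertex_seq))/orP[|//].
case/hasP=> c c_cyc /allP cA forestA.
have W_cyclesP : all (fun c => (2 < size c) && ucycleb W c) W_cycles by vm_compute.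
have /andP[c_gt2 c_ucycle] := allP W_cyclesP _ c_cyc.
case: (forestA c) => // x /cA xA.
by have := xA : x \in filter _ _; rewrite mem_filter => /andP[].
Qed.

Lemma mem_Wvertex_filter (A : {set Wvertex}) x :
  (x \in [seq y <- Wvertex_seq | y \in A]) = (x \in A).
Proof. by rewrite mem_filter; case: x; rewrite andbT. Qed.

Lemma card_Wvertex_set (A : {set Wvertex}) :
  #|A| = size [seq x <- Wvertex_seq | x \in A].
Proof.
rewrite cardE; apply/perm_size/uniq_perm; rewrite ?enum_uniq ?filter_uniq //.
by move=> x; rewrite mem_enum mem_Wvertex_filter.
Qed.

Lemma W_forest_bound_uv (A : {set Wvertex}) : induces_forest W A ->
  #|A| + ((Wu \in A) && (Wv \in A)) <= 5.
Proof.
move/(@W_forest_ind _ (fun s => size s + ((Wu \in s) && (Wv \in s)) <= 5)).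
by rewrite !mem_Wvertex_filter card_Wvertex_set; apply; vm_compute.
Qed.

Lemma W_forest_bound_u (A : {set Wvertex}) : induces_forest W A ->
  2 * #|A| + 2 * (Wu \in A) <= 10 + ((Wu \in A) && (Wz \in A)) +
    ((Wu \in A) && (Wx1 \in A)) + ((Wu \in A) && (Wt \in A)).
Proof.
move/(@W_forest_ind _ (fun s => 2 * size s + 2 * (Wu \in s) <=
  10 + ((Wu \in s) && (Wz \in s)) + ((Wu \in s) && (Wx1 \in s)) +
    ((Wu \in s) && (Wt \in s)))).
by rewrite !mem_Wvertex_filter card_Wvertex_set; apply; vm_compute.
Qed.

Lemma card_Wvertex : #|{: Wvertex}| = 10.
Proof. by rewrite -cardsT card_Wvertex_set /= !inE. Qed.

(** * Lower bound, by summing over the colours *)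

Lemma W_coloring_bound_uv (p q : nat) (c : Wvertex -> {set 'I_p}) :
  forest_coloring W q c -> 10 * q + #|c Wu :&: c Wv| <= 5 * p.
Proof.
case=> c_card c_forest.
have := @leq_sum _ (index_enum _) xpredT _ _
  (fun (i : 'I_p) _ => W_forest_bound_uv (c_forest i)).
rewrite big_split /= sum_card_color_classes (eq_bigr _ (fun x _ => c_card x)).
rewrite !sum_nat_const card_Wvertex card_ord [p * 5]mulnC.
by under eq_bigr do rewrite !inE; rewrite sum_mem_setI.
Qed.

Lemma W_coloring_bound_u (p q : nat) (c : Wvertex -> {set 'I_p}) :
  forest_coloring W q c ->
  22 * q <= 10 * p + #|c Wu :&: c Wz| + #|c Wu :&: c Wx1| + #|c Wu :&: c Wt|.
Proof.
case=> c_card c_forest.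
have := @leq_sum _ (index_enum _) xpredT _ _
  (fun (i : 'I_p) _ => W_forest_bound_u (c_forest i)).
rewrite !big_split /= sum_card_color_classes.
rewrite (eq_bigr _ (fun x _ => c_card x)) !sum_nat_const card_Wvertex card_ord.
have -> : \sum_(i < p) (Wu \in [set x | i \in c x]) = q.
  rewrite -(c_card Wu) -(setIid (c Wu)) -sum_mem_setI.
  by apply: eq_bigr => i _; rewrite inE andbb.
have sumE x y : \sum_(i < p) ((x \in [set x | i \in c x]) && (y \in [set x | i \in c x]))
    = #|c x :&: c y|.
  by rewrite -sum_mem_setI; apply: eq_bigr => i _; rewrite !inE.
rewrite !sumE; set mz := #|_|; set m1 := #|_|; set mt := #|_|; lia.
Qed.

Lemma W1_ends_adj flip i : W (W1_ends flip i).1 (W1_ends flip i).2.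
Proof. by rewrite /W1_ends; case: (flip i); case: i => -[|[|[|]]]. Qed.

Lemma W1_coloring_bound flip (p q : nat) :
  forest_colorable (W1 flip) p q -> 52 * q <= 25 * p.
Proof.
case=> c c_col.
have inl_inj : injective (@inl Wvertex ('I_3 * inner Wu Wv)) by move=> x y [].
have W0_hom x y : W x y -> W1 flip (inl x) (inl y) by apply: inl_hom W_sym _.
have := W_coloring_bound_u (forest_coloring_preim inl_inj W0_hom c_col).
have shared i : 10 * q +
    #|c (inl (W1_ends flip i).1) :&: c (inl (W1_ends flip i).2)| <= 5 * p.
  have ends_neq : (W1_ends flip i).1 != (W1_ends flip i).2.
    by apply/eqP=> E; have := W1_ends_adj flip i; rewrite E W_irr.
  have copy_hom := @in_copy_hom _ W _ W Wu Wv _ (W1_ends flip) i.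
  have := W_coloring_bound_uv
    (forest_coloring_preim (in_copy_inj ends_neq) copy_hom c_col).
  by rewrite /= in_copy_a in_copy_b.
have shared_u i : 10 * q +
    #|c (inl Wu) :&: c (inl (tnth [tuple Wz; Wx1; Wt] i))| <= 5 * p.
  (* The orientation [flip i] only swaps the two sides of the intersection. *)
  by have := shared i; rewrite /W1_ends; case: (flip i) => //=; rewrite setIC.
move: (shared_u (inord 0)) (shared_u (inord 1)) (shared_u (inord 2)).
by rewrite !(tnth_nth Wu) /= !inordK //=; lia.
Qed.

(** * Explicit colour classes *)

(* The 52 colour classes, as integer solutions of the two linear programs dual
   to the bounds above, in which [u] shares 10 colours with each of [z], [x1],
   [t] (resp. with [v]).  Each class is listed so that every vertex has at most
   one earlier neighbour, starting with [u] and [v] when they occur. *)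
Definition base_classes : seq (seq Wvertex) :=
  nseq 3 [:: Ww; Wt; Wx1; Wx3; Wz] ++
  nseq 9 [:: Wu; Wv; Wx4; Ww] ++
  nseq 5 [:: Wu; Wz; Wt; Wx4; Ww] ++
  nseq 5 [:: Wu; Wz; Wx1; Wx3; Wx4] ++
  nseq 5 [:: Wu; Wt; Wx1; Wx4; Wx3] ++
  nseq 4 [:: Wv; Wz; Wt; Wx2; Wx5] ++
  nseq 8 [:: Ww; Wx2; Wz; Wx5; Wt] ++
  nseq 12 [:: Wv; Wx3; Wx2; Wx1; Wx5] ++
  nseq 1 [:: Wu; Wx2; Wx5; Wx4].

Definition copy_classes : seq (seq Wvertex) :=
  nseq 6 [:: Wu; Wv; Wx2; Ww] ++
  nseq 11 [:: Wu; Wz; Wt; Wx3; Ww] ++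
  nseq 2 [:: Wu; Wz; Wx1; Ww; Wx4] ++
  nseq 2 [:: Wu; Wt; Wx1; Wx4; Wx3] ++
  nseq 6 [:: Wz; Wx1; Wx3; Wx4; Wt] ++
  nseq 4 [:: Wu; Wv; Wx2; Wx5] ++
  nseq 6 [:: Ww; Wx3; Wz; Wx5; Wt] ++
  nseq 15 [:: Wv; Wx4; Wx5; Wx1; Wx2].

(** [index] would give [u] or [v] the large value [size s] in a class that misses it, whereas gluing
    needs both ranked lowest in every class. *)
Definition copy_rank (s : seq Wvertex) (x : Wvertex) : nat :=
  if (x == Wu) || (x == Wv) then 0 else index x s.

Definition forest_rankb (s : seq Wvertex) (r : Wvertex -> nat) : bool :=
  all (fun x => all (fun y => all (fun z =>
    [&& W x y, W x z, r y <= r x & r z <= r x] ==> (y == z)) s) s) s.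

Lemma forest_rankbP s r : forest_rankb s r -> forest_rank W (mem s) r.
Proof.
move=> /allP sP x y z xs ys zs xy xz ryx rzx; apply/eqP.
have /allP/(_ y ys)/allP/(_ z zs)/implyP := sP x xs.
by apply; apply/and4P.
Qed.

Lemma base_classes_forest s : s \in base_classes ->
  forest_rank W (mem s) (index^~ s).
Proof.
have /allP sP : all (fun s => forest_rankb s (index^~ s)) base_classes.
  by vm_compute.
by move=> /sP/forest_rankbP.
Qed.

Lemma copy_classes_forest s : s \in copy_classes ->
  forest_rank W (mem s) (copy_rank s).
Proof.
have /allP sP : all (fun s => forest_rankb s (copy_rank s)) copy_classes.
  by vm_compute.
by move=> /sP/forest_rankbP.
Qed.

Lemma card_class_members (T : eqType) (p : nat) (L : seq (seq T)) (x : T) :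
  size L = p ->
  #|[set i : 'I_p | x \in nth [::] L i]| = count (fun s => x \in s) L.
Proof.
move=> <-; rewrite -sum1_card -sum1_count (big_nth [::]) big_mkord.
by apply: eq_bigl => i; rewrite inE.
Qed.

Lemma count_base_classes x : count (fun s => x \in s) base_classes = 25.
Proof. by case: x; vm_compute. Qed.

Lemma count_copy_classes x : count (fun s => x \in s) copy_classes = 25.
Proof. by case: x; vm_compute. Qed.

(** * Gluing the colourings of [W_0] and of the copies *)

Lemma perm_map_lift (T S : eqType) (g : T -> S) (t : seq S) (L : seq T) :
  perm_eq t (map g L) -> exists2 L', perm_eq L' L & map g L' = t.
Proof.
case: L => [|x0 L]; first by move/perm_nilP->; exists [::].
case/(perm_iotaP (g x0)) => Is; rewrite size_map => Is_perm ->.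
set M := x0 :: L in Is_perm *; exists (map (nth x0 M) Is).
  rewrite -[X in perm_eq _ X](take_size M) -(map_nth_iota0 x0 (leqnn (size M))).
  exact: perm_map.
rewrite -map_comp; apply/eq_in_map => i.
by rewrite (perm_mem Is_perm) mem_iota => iM; apply/esym/nth_map.
Qed.

(** Only the traces on the two glued vertices matter. In both lists 10 classes contain both
    vertices, 15 only the first, 15 only the second and 12 neither, so a permutation of the colours
    matches them in either orientation. *)
Lemma W1_copy_classes flip (i : 'I_3) : exists L : seq (seq Wvertex),
  [/\ perm_eq L copy_classes,
      forall j, ((W1_ends flip i).1 \in nth [::] base_classes j)
                = (Wu \in nth [::] L j)
    & forall j, ((W1_ends flip i).2 \in nth [::] base_classes j)
                = (Wv \in nth [::] L j)].
Proof.
pose tr (x y : Wvertex) (s : seq Wvertex) := (x \in s, y \in s).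
have: perm_eq (map (tr (W1_ends flip i).1 (W1_ends flip i).2) base_classes)
              (map (tr Wu Wv) copy_classes).
  by rewrite /W1_ends; case: (flip i); case: i => -[|[|[|]]] //= ?; vm_compute.
case/perm_map_lift=> L L_perm L_tr; exists L.
have sizeL : size L = size base_classes by rewrite (perm_size L_perm).
have nth_tr j : tr (W1_ends flip i).1 (W1_ends flip i).2 (nth [::] base_classes j)
    = tr Wu Wv (nth [::] L j).
  (* Past the end both lists yield [[::]], whose trace is [(false, false)]. *)
  case: (ltnP j (size L)) => [j_lt|j_ge]; last first.
    by rewrite !nth_default // -sizeL.
  rewrite -(nth_map _ (false, false)) -?sizeL // -L_tr.
  by rewrite (nth_map [::]).
by split=> // j; case: (nth_tr j).
Qed.

Lemma W1_colorable flip : forest_colorable (W1 flip) 52 25.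
Proof.
have [L L_P] := fin_all_exists (W1_copy_classes flip).
pose c (p : repl_vertex Wvertex Wu Wv 3) : {set 'I_52} :=
  match p with
  | inl x => [set j : 'I_52 | x \in nth [::] base_classes j]
  | inr (i, y) => [set j : 'I_52 | val y \in nth [::] (L i) j]
  end.
(* On glued vertices [c] reads [base_classes]; the matching of traces lets it be read from [L i] as
   well. *)
have c_copy (j : 'I_52) i x :
    (j \in c (in_copy Wu Wv (W1_ends flip) i x)) = (x \in nth [::] (L i) j).
  have [_ Lu Lv] := L_P i.
  by case: in_copyP => [->|->|y ->]; rewrite /= inE ?Lu ?Lv.
have sizeL i : size (L i) = 52 by have [/perm_size-> _ _] := L_P i.
exists c; split=> [[x|[i y]]|j] /=.
- by rewrite card_class_members // count_base_classes.
- have [/permP L_perm _ _] := L_P i.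
  by rewrite card_class_members // L_perm count_copy_classes.
apply: (@repl_edges_forest _ _ _ _ _ _ _ _ _
          (index^~ (nth [::] base_classes j))
          (fun i => copy_rank (nth [::] (L i) j))).
- exact: W_sym.
- exact: W_irr.
- exact: W1_ends_adj.
- exact: W1_sym.
- have /base_classes_forest base_j : nth [::] base_classes j \in base_classes.
    by rewrite mem_nth.
  move=> x y z; rewrite !inE; exact: base_j.
- move=> i; have /copy_classes_forest copy_j : nth [::] (L i) j \in copy_classes.
    by have [/perm_mem <- _ _] := L_P i; rewrite mem_nth // sizeL.
  move=> x y z; rewrite !inE !c_copy; exact: copy_j.
by [].
Qed.

(** * The value as a minimum of fractions *)

Lemma ler_natr_div (F : numFieldType) (m n p q : nat) :
  0 < n -> 0 < q -> m * q <= n * p -> (m%:R / n%:R <= p%:R / q%:R :> F)%R.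
Proof.
move=> n_gt0 q_gt0 le_mp.
rewrite ler_pdivlMr ?ltr0n // mulrAC ler_pdivrMr ?ltr0n // -!natrM ler_nat.
by rewrite [p * n]mulnC.
Qed.

Theorem theorem5 (flip : 'I_3 -> bool) :
  is_frac_arboricity (W1 flip) (2 + 2 / 25)%R.
Proof.
split.
  by exists 52, 25; split=> //; exact: W1_colorable.
move=> p q p_gt0 q_gt0 /W1_coloring_bound le_pq.
have -> : (2 + 2 / 25 = 52%:R / 25%:R :> rat)%R by [].
exact: ler_natr_div.
Qed.
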